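(* Let $\mathfrak{M}=(\mathbf{M},\models,\mathcal{P}(\mathscr{L}))$ be a normal abstract model structure. For $\Sigma\subseteq\mathscr{L}$ let $\mathsf{ModFin}(\Sigma)=\{m\in\mathbf{M}\mid m\models\Sigma_0\text{ for some }\Sigma_0\in\mathsf{FinSet}(\Sigma)\}$. Suppose that for every $\Sigma\subseteq\mathscr{L}$ and every ultrafilter $\mathcal{U}$ on $\mathsf{FinSet}(\Sigma)$, every family $(m_{\Sigma_0})_{\Sigma_0\in\mathsf{FinSet}(\Sigma)}$ of elements of $\mathsf{ModFin}(\Sigma)$ has a $\mathcal{U}$-Łoś-model. Then $\mathfrak{M}$ is compact iff for each $\Sigma\subseteq\mathscr{L}$, $\mathsf{ModFin}(\Sigma)$ is pseudo-closed under Łoś-models relative to $\mathsf{FinSet}(\Sigma)$.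
   Context: An abstract model structure is a triple $(\mathbf{M},\models,\mathcal{P}(\mathscr{L}))$ with $\mathbf{M}\neq\emptyset$, $\mathscr{L}$ a set and $\models\,\subseteq\mathbf{M}\times\mathcal{P}(\mathscr{L})$. It is normal if for all $m$ and $\Gamma$: $m\models\Gamma$ iff $m\models\{\alpha\}$ for all $\alpha\in\Gamma$. $\Gamma$ is satisfiable if $m\models\Gamma$ for some $m$, finitely satisfiable if every finite subset is satisfiable; $\mathfrak{M}$ is compact if for all $\Gamma\subseteq\mathscr{L}$, $\Gamma$ is satisfiable iff finitely satisfiable. $\mathsf{FinSet}(\Sigma)$ is the set of finite subsets of $\Sigma$. $\mathsf{Th}(X)=\{\alpha\in\mathscr{L}\mid m\models\{\alpha\}\text{ for all }m\in X\}$ for $X\subseteq\mathbf{M}$. For $m,n\in\mathbf{M}$ write $m\preceq n$ iff $\mathsf{Th}(\{m\})\subseteq\mathsf{Th}(\{n\})$, and $\mathbb{U}(m)=\{n\in\mathbf{M}\mid m\preceq n\}$. Given a family $(m_i)_{i\in I}$ in $\mathbf{M}$ and an ultrafilter $\mathcal{U}$ on $I$, an element $\mathsf{l}\in\mathbf{M}$ is a $\mathcal{U}$-Łoś-model of $(m_i)$ if for all $\Sigma\subseteq\mathscr{L}$: $\mathsf{l}\models\Sigma$ iff $\{i\in I\mid m_i\models\Sigma\}\in\mathcal{U}$. A set $\mathbf{K}\subseteq\mathbf{M}$ is pseudo-closed under Łoś-models relative to a set $I$ if for every family $(m_i)_{i\in I}$ of elements of $\mathbf{K}$ and every ultrafilter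 $\mathcal{U}$ on $I$, every $\mathcal{U}$-Łoś-model $\mathsf{l}$ of $(m_i)$ satisfies $\mathbb{U}(\mathsf{l})\cap\mathbf{K}\neq\emptyset$. *)

(* Defs.v *)
From mathcomp Require Import all_boot boolp classical_sets cardinality filter.
Set Implicit Arguments.
Unset Strict Implicit.
Unset Printing Implicit Defensive.

Local Open Scope classical_set_scope.

Record modelStructure := ModelStructure {
  model : Type;
  sentence : Type;
  models : model -> set sentence -> Prop;
  model_nonempty : inhabited model
}.

Declare Scope model_scope.
Delimit Scope model_scope with model.
Notation "m |= S" := (models m S) (at level 70, no associativity) : model_scope.
Open Scope model_scope.

Section ModelStructureDefs.
Variable MM : modelStructure.
Local Notation M := (model MM).
Local Notation L := (sentence MM).
Implicit Types (m n l : M) (Gamma Sigma : set L) (X K : set M).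

Definition normal : Prop :=
  forall m Gamma, m |= Gamma <-> (forall a : L, Gamma a -> m |= [set a]).

Definition satisfiable Gamma : Prop := exists m, m |= Gamma.

Definition finite_subsets Sigma : set (set L) :=
  [set Sigma0 | finite_set Sigma0 /\ Sigma0 `<=` Sigma].

Definition finitely_satisfiable Gamma : Prop :=
  forall Gamma0, finite_subsets Gamma Gamma0 -> satisfiable Gamma0.

Definition compact_structure : Prop :=
  forall Gamma, satisfiable Gamma <-> finitely_satisfiable Gamma.

Definition Th X : set L := [set a | forall m, X m -> m |= [set a]].

Definition preceq m n : Prop := Th [set m] `<=` Th [set n].

Definition upset m : set M := [set n | preceq m n].

Definition Los_model (I : Type) (U : set_system I) (f : I -> M) l : Prop :=
  forall Sigma, l |= Sigma <-> U [set i | f i |= Sigma].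

Definition Los_pseudo_closed (I : Type) K : Prop :=
  forall (f : I -> M), (forall i, K (f i)) ->
  forall U : set_system I, UltraFilter U ->
  forall l, Los_model U f l -> upset l `&` K !=set0.

Definition ModFin Sigma : set M :=
  [set m | exists Sigma0, finite_subsets Sigma Sigma0 /\ m |= Sigma0].

End ModelStructureDefs.

Arguments normal MM : clear implicits.
Arguments compact_structure MM : clear implicits.

(* Main.v *)
Require Import Defs.
From mathcomp Require Import all_boot boolp classical_sets cardinality filter.

(** Every model satisfies the empty set by normality, so [ModFin Sigma] is the
    whole class of models and a Łoś-model [l] itself lies in
    [upset l `&` ModFin Sigma].  For compactness, choose a model of each finite
    subset of [Gamma]; a Łoś-model of this family with respect to an ultrafilter
    containing all the cones [{Delta | Delta0 `<=` Delta}] satisfies every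
    element of [Gamma]. *)

Local Open Scope classical_set_scope.

Definition cone (MM : modelStructure) (Sigma : set (sentence MM))
    (D0 : finite_subsets Sigma) : set (finite_subsets Sigma) :=
  [set D | \val D0 `<=` \val D].

(** The cones form a filter base: the cone of a union [D1 ∪ D2] is the intersection of the two
    cones, and no cone is empty because it contains its own vertex. *)
Lemma cone_proper_filter (MM : modelStructure) (Sigma : set (sentence MM)) :
  ProperFilter (filter_from setT (@cone MM Sigma)).
Proof.
have e0 : set0 \in finite_subsets Sigma by apply/mem_set; split.
apply: filter_from_proper; last by move=> D _; exists D.
apply: filter_from_filter; first by exists (SigSub e0).
move=> [D1 e1] [D2 e2] _ _; have [[f1 s1] [f2 s2]] := (set_mem e1, set_mem e2).
have eU : (D1 `|` D2) \in finite_subsets Sigma.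
  by apply/mem_set; split; [rewrite finite_setU | rewrite subUset].
by exists (SigSub eU) => // D; rewrite /cone /= subUset.
Qed.

Section Normal.
Variables (MM : modelStructure) (normalMM : normal MM).
Implicit Types (m : model MM) (Gamma Delta Sigma : set (sentence MM)).

Lemma models_sub m Gamma Delta : Delta `<=` Gamma -> m |= Gamma -> m |= Delta.
Proof.
by move=> sDG /normalMM mG; apply/normalMM => a /sDG; exact: mG.
Qed.

Lemma ModFinT Sigma m : ModFin Sigma m.
Proof. by exists set0; split; [split | apply/normalMM]. Qed.

Lemma finitely_satisfiable_Los_model Gamma :
    (forall U : set_system (finite_subsets Gamma), UltraFilter U ->
      forall f : finite_subsets Gamma -> model MM, exists l, Los_model U f l) ->
  finitely_satisfiable Gamma -> satisfiable Gamma.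
Proof.
move=> hasLos finG.
have [f fP] : {f : finite_subsets Gamma -> model MM & forall D, f D |= \val D}.
  by apply: (@choice _ _ (fun D m => m |= \val D)) => D;
     exact: finG (set_mem (valP D)).
have [U [ultraU sU]] := ultraFilterLemma (cone_proper_filter MM Gamma).
have [l lP] := hasLos U ultraU f.
(* Normality reduces the goal to singletons [[set a]], where the Łoś property turns it into
   membership in [U]. *)
exists l; apply/normalMM => a Ga; apply/lP.
have ea : [set a] \in finite_subsets Gamma.
  by apply/mem_set; split; [exact: finite_set1 | move=> _ ->].
(* On the cone of [[set a]], [f D] satisfies all of [D], hence [a]. *)
by apply: sU; exists (SigSub ea) => // D sD; apply: models_sub (fP D).
Qed.

End Normal.

Theorem theorem3p47 (MM : modelStructure) (normalMM : normal MM)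
    (has_Los_models :
      forall (Sigma : set (sentence MM)) (U : set_system (finite_subsets Sigma)),
        UltraFilter U ->
      forall f : finite_subsets Sigma -> model MM,
        (forall i, ModFin Sigma (f i)) ->
      exists l, Los_model U f l) :
  compact_structure MM <->
  (forall Sigma : set (sentence MM),
     Los_pseudo_closed (finite_subsets Sigma) (ModFin Sigma)).
Proof.
split=> [_ Sigma f _ U _ l _ | _ Gamma].
  by exists l; split; [move=> a | exact: ModFinT].
split=> [[m mG] Delta [_ sDG]|].
  by exists m; exact: models_sub mG.
apply: finitely_satisfiable_Los_model => // U ultraU f.
(* Any family [f] qualifies, since [ModFin Gamma] contains every model. *)
by apply: has_Los_models => D; exact: ModFinT.
Qed.
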